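(* Let $n\ge 2$ be an integer for which a real Hadamard matrix $H$ of order $n$ with first column $\mathbf 1$ exists. Then $Q=H/\sqrt n$ satisfies $M(Q)=1$. Hence every Suleĭmanova spectrum $(1,\lambda_2,\dots,\lambda_n)$ with $1+\sum_{j=2}^n\lambda_j>0$ is realised by a symmetric doubly stochastic matrix via $Q\Lambda Q^{\top}$ with $\Lambda=\operatorname{diag}(1,\lambda_2,\dots,\lambda_n)$; that is, $Q\Lambda Q^{\top}$ is a symmetric doubly stochastic matrix with spectrum $(1,\lambda_2,\dots,\lambda_n)$.
   Context: $\mathbf 1$ denotes the all-ones vector. A real Hadamard matrix of order $n$ is an $n\times n$ matrix with entries $\pm1$ and pairwise orthogonal columns. A real square matrix is doubly stochastic if its entries are non-negative and all its row sums and column sums equal $1$. A Suleĭmanova spectrum is a list $(1,\lambda_2,\dots,\lambda_n)$ with $\lambda_j\in[-1,0]$ for $j\ge 2$ (not necessarily sorted). For a real orthogonal $n\times n$ matrix $Q=[q_0,\dots,q_{n-1}]$ with first column $q_0=\mathbf 1/\sqrt n$, the coherence is \[ M(Q):=\sup_{1\le j\le n-1}\ \sup_{0\le k,l\le n-1}n\,|q_j(k)q_j(l)|=n\max_{1\le j\le n-1}\|q_j\|_\infty^2 . \] *)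

(* Defs.v *)
From mathcomp Require Import all_boot all_order all_algebra.
From mathcomp Require Import reals.

Set Implicit Arguments.
Unset Strict Implicit.
Unset Printing Implicit Defensive.

Import Order.TTheory GRing.Theory Num.Theory.
Local Open Scope ring_scope.

Definition hadamard (R : realType) (n : nat) (H : 'M[R]_n) : Prop :=
  (forall i j : 'I_n, H i j = 1 \/ H i j = -1) /\
  (forall j k : 'I_n, j != k -> \sum_(i < n) H i j * H i k = 0).

(* The condition on j is vacuous for n = 0, and for n > 0 selects column 0. *)
Definition first_col_const (R : realType) (n : nat) (c : R) (A : 'M[R]_n) :
    Prop :=
  forall i j : 'I_n, j = 0%N :> nat -> A i j = c.

Definition orthogonal_mx (R : realType) (n : nat) (Q : 'M[R]_n) : Prop :=
  Q^T *m Q = 1%:M.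

(* M(Q), where q_j is column j of Q, so that q_j(k) = Q k j.  All terms are
   non-negative, so the default value 0 of the finite maxima does not alter the
   suprema whenever the index ranges are nonempty, i.e. for n >= 2. *)
Definition coherence (R : realType) (n : nat) (Q : 'M[R]_n) : R :=
  \big[Num.max/0]_(j < n | (0 < j)%N)
    \big[Num.max/0]_(kl : 'I_n * 'I_n) (n%:R * `|Q kl.1 j * Q kl.2 j|).

Definition doubly_stochastic (R : realType) (n : nat) (A : 'M[R]_n) : Prop :=
  [/\ forall i j : 'I_n, 0 <= A i j,
      forall i : 'I_n, \sum_(j < n) A i j = 1
    & forall j : 'I_n, \sum_(i < n) A i j = 1].

(* Entry j of s is lambda_(j+1): indices start at 0 here. *)
Definition suleimanova (R : realType) (n : nat) (s : 'rV[R]_n) : Prop :=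
  forall j : 'I_n,
    if j == 0%N :> nat then s 0 j = 1 else -1 <= s 0 j <= 0.

(* The eigenvalues of A, counted with algebraic multiplicity and in no
   particular order, are the entries of s. *)
Definition has_spectrum (R : realType) (n : nat) (A : 'M[R]_n) (s : 'rV[R]_n) :
    Prop :=
  char_poly A = \prod_(j < n) ('X - (s 0 j)%:P).

(* Main.v *)
Require Import Defs.
From mathcomp Require Import all_boot all_order all_algebra.
From mathcomp Require Import reals.

Set Implicit Arguments.
Unset Strict Implicit.
Unset Printing Implicit Defensive.

Import Order.TTheory GRing.Theory Num.Theory.
Local Open Scope ring_scope.

(** Both conclusions about [Q = H / sqrt n] come from the flatness of a Hadamard
    matrix: all its entries have absolute value 1, so each product of two entries of
    [Q] has absolute value exactly [1/n], which is the value 1 of the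
    coherence ([coherence_flat]).

    Coherence at most 1 suffices for the realisation of spectra, for any
    orthogonal [Q] whose first column is [1 / sqrt n].  Let [L = diag s] and
    [A = Q L Q^T].
    - [A] is symmetric, and similar to [L], so its spectrum is [s]
      ([has_spectrum_orthogonal_conj]).
    - The first column of [Q], a multiple of the all-ones vector, is an
      eigenvector of [A] for the eigenvalue [s 0 = 1]
      ([orthogonal_conj_col]).  So the rows of [A] sum to 1, and by symmetry
      the columns do too.
    - The [(i, k)] entry of [n A] is [1 + \sum_(j > 0) s j * (n Q i j Q k j)].
      As [s j <= 0] and [n Q i j Q k j <= 1], it is at least
      [1 + \sum_(j > 0) s j], which is positive for the spectra considered
      ([orthogonal_conj_ge0]). *)

Lemma trmx_orthogonal_conj (R : realType) (n : nat) (Q : 'M[R]_n)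
    (s : 'rV[R]_n) :
  (Q *m diag_mx s *m Q^T)^T = Q *m diag_mx s *m Q^T.
Proof. by rewrite !trmx_mul trmxK tr_diag_mx mulmxA. Qed.

Lemma has_spectrum_orthogonal_conj (R : realType) (n : nat) (Q : 'M[R]_n)
    (s : 'rV[R]_n) :
  orthogonal_mx Q -> has_spectrum (Q *m diag_mx s *m Q^T) s.
Proof.
move=> Qorth; have QQt : Q *m Q^T = 1%:M by apply: mulmx1C.
rewrite /has_spectrum.
have -> : \prod_(j < n) ('X - (s 0 j)%:P) = char_poly (diag_mx s).
  rewrite char_poly_trig ?diag_mx_is_trig //.
  by apply: eq_bigr => j _; rewrite mxE eqxx.
rewrite /char_poly /char_poly_mx.
set P := map_mx polyC Q; set D := map_mx polyC (diag_mx s).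
have PPt : P *m P^T = 1%:M by rewrite map_trmx -map_mxM QQt map_mx1.
(* 'X is central, so conjugating by the constant matrix Q commutes with
   forming the characteristic matrix. *)
have -> : 'X%:M - map_mx polyC (Q *m diag_mx s *m Q^T) = P *m ('X%:M - D) *m P^T.
  rewrite mulmxBr mulmxBl !map_mxM -map_trmx; congr (_ - _).
  by rewrite scalar_mxC -mulmxA PPt mulmx1.
by rewrite !det_mulmx mulrAC -det_mulmx PPt det1 mul1r.
Qed.

Lemma orthogonal_conj_col (R : realType) (n : nat) (Q : 'M[R]_n)
    (s : 'rV[R]_n) (j : 'I_n) :
  orthogonal_mx Q ->
  Q *m diag_mx s *m Q^T *m col j Q = s 0 j *: col j Q.
Proof.
move=> Qorth; rewrite !colE -!mulmxA (mulmxA Q^T) Qorth mul1mx scalemxAr; congr (_ *m _).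
apply/matrixP=> i k; rewrite mul_diag_mx !mxE.
by case: eqVneq => [->|_]; rewrite ?mulr0.
Qed.

Lemma orthogonal_conjE (R : realType) (n : nat) (Q : 'M[R]_n) (s : 'rV[R]_n)
    (i k : 'I_n) :
  (Q *m diag_mx s *m Q^T) i k = \sum_(j < n) s 0 j * (Q i j * Q k j).
Proof.
rewrite mxE; apply: eq_bigr => j _.
by rewrite mul_mx_diag !mxE mulrAC mulrC.
Qed.

Lemma coherence_ge (R : realType) (n : nat) (Q : 'M[R]_n) (j k l : 'I_n) :
  (0 < j)%N -> n%:R * `|Q k j * Q l j| <= coherence Q.
Proof.
move=> j0; rewrite /coherence.
apply: (bigmax_sup j) => //.
exact: (bigmax_sup (k, l)).
Qed.

Lemma coherence_flat (R : realType) (n : nat) (Q : 'M[R]_n) (c : R) :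
  (2 <= n)%N -> 0 <= c ->
  (forall i k l : 'I_n, n%:R * `|Q k i * Q l i| = c) -> coherence Q = c.
Proof.
move=> n2 c0 Qc; apply/le_anti/andP; split.
  by do 2!(apply: bigmax_le => // ? _); rewrite Qc.
(* The order is at least 2, so some column other than the first exists. *)
pose j := Ordinal n2; rewrite -(Qc j j j); exact: coherence_ge.
Qed.

(** The first column contributes exactly [1/n] to each entry, and coherence at
    most 1 limits the loss caused by every other column [j] to [- s j / n]. *)
Lemma orthogonal_conj_ge0 (R : realType) (n : nat) (Q : 'M[R]_n)
    (s : 'rV[R]_n) (i k : 'I_n) :
  first_col_const (Num.sqrt n%:R)^-1 Q -> coherence Q <= 1 ->
  suleimanova s -> 0 <= 1 + \sum_(j < n | (0 < j)%N) s 0 j ->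
  0 <= (Q *m diag_mx s *m Q^T) i k.
Proof.
move=> Q0 cohQ sS sum_ge0.
have n_gt0 : (0 < n)%N by apply: leq_trans (ltn_ord i).
have nR_gt0 : 0 < n%:R :> R by rewrite ltr0n.
pose j0 := Ordinal n_gt0.
rewrite orthogonal_conjE -(pmulr_rge0 _ nR_gt0) (bigD1 j0) //= mulrDr.
have -> : s 0 j0 = 1 by have := sS j0.
rewrite mul1r !Q0 // -invfM -expr2 sqr_sqrtr ?ler0n // divff ?gt_eqF //.
apply: le_trans sum_ge0 _; rewrite lerD2l mulr_sumr.
rewrite (eq_bigl (fun j : 'I_n => j != j0)); last by move=> j; rewrite lt0n.
apply: ler_sum => j j_neq0.
have j_gt0 : (0 < j)%N by rewrite lt0n.
have /andP[_ sj_le0] : -1 <= s 0 j <= 0.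
  by have := sS j; rewrite -[_ == _ :> nat]negbK -lt0n j_gt0.
rewrite mulrCA -[leLHS]mulr1 ler_wnM2l //.
apply: le_trans (le_trans (coherence_ge Q i k j_gt0) cohQ).
by rewrite ler_wpM2l ?ler_norm ?ltW.
Qed.

Lemma doubly_stochastic_orthogonal_conj (R : realType) (n : nat) (Q : 'M[R]_n)
    (s : 'rV[R]_n) :
  orthogonal_mx Q -> first_col_const (Num.sqrt n%:R)^-1 Q ->
  coherence Q <= 1 -> suleimanova s ->
  0 <= 1 + \sum_(j < n | (0 < j)%N) s 0 j ->
  doubly_stochastic (Q *m diag_mx s *m Q^T).
Proof.
move=> Qorth Q0 cohQ sS sum_ge0.
set A := Q *m diag_mx s *m Q^T.
have rowA (i : 'I_n) : \sum_(j < n) A i j = 1.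
  have n_gt0 : (0 < n)%N by apply: leq_trans (ltn_ord i).
  pose j0 := Ordinal n_gt0.
  have c_neq0 : (Num.sqrt n%:R)^-1 != 0 :> R.
    by rewrite invr_eq0 sqrtr_eq0 -ltNge ltr0n.
  have /matrixP/(_ i 0) := orthogonal_conj_col s j0 Qorth.
  have -> : s 0 j0 = 1 by have := sS j0.
  rewrite scale1r !mxE Q0 // => rowE; apply: (mulIf c_neq0).
  rewrite mul1r mulr_suml -[RHS]rowE.
  by apply: eq_bigr => j _; rewrite [col _ _ _ _]mxE Q0.
split=> // [i j | j]; first exact: orthogonal_conj_ge0.
rewrite -[RHS](rowA j); apply: eq_bigr => i _.
by rewrite -[A in LHS](trmx_orthogonal_conj Q s) mxE.
Qed.

Lemma hadamard_gram (R : realType) (n : nat) (H : 'M[R]_n) :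
  hadamard H -> H^T *m H = n%:R%:M.
Proof.
case=> H1 Hcol; apply/matrixP=> j k; rewrite !mxE.
under eq_bigr do rewrite mxE.
case: eqVneq => [<-|/Hcol //]; rewrite mulr1n.
rewrite (eq_bigr (fun=> 1)) ?sumr_const ?card_ord // => i _.
by case: (H1 i j) => ->; rewrite ?mulrNN mulr1.
Qed.

Theorem theorem12 (R : realType) (n : nat) (H : 'M[R]_n)
    (hn : (2 <= n)%N) (hH : hadamard H) (hH1 : first_col_const 1 H) :
  let Q : 'M[R]_n := (Num.sqrt n%:R)^-1 *: H in
  [/\ orthogonal_mx Q,
      first_col_const (Num.sqrt n%:R)^-1 Q,
      coherence Q = 1
    & forall s : 'rV[R]_n,
        suleimanova s ->
        0 < 1 + \sum_(j < n | (0 < j)%N) s 0 j ->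
        let A : 'M[R]_n := Q *m diag_mx s *m Q^T in
        [/\ A^T = A, doubly_stochastic A & has_spectrum A s]].
Proof.
move=> Q.
have nR_neq0 : n%:R != 0 :> R by rewrite pnatr_eq0 -lt0n ltnW.
have cc : (Num.sqrt n%:R)^-1 * (Num.sqrt n%:R)^-1 = n%:R^-1 :> R.
  by rewrite -invfM -expr2 sqr_sqrtr ?ler0n.
have Qorth : orthogonal_mx Q.
  rewrite /orthogonal_mx /Q -scalemxAr linearZ /= -scalemxAl scalerA cc.
  by rewrite hadamard_gram // scale_scalar_mx mulVf.
have Q0 : first_col_const (Num.sqrt n%:R)^-1 Q.
  by move=> i j j0; rewrite mxE hH1 // mulr1.
have cohQ : coherence Q = 1.
  apply: coherence_flat => // j k l.
  have normH i : `|H i j| = 1.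
    by case: (hH.1 i j) => ->; rewrite ?normrN normr1.
  by rewrite !mxE mulrACA cc !normrM !normH !mulr1 ger0_norm ?invr_ge0 ?ler0n ?divff.
split=> // s sS sum_gt0 A; split.
- exact: trmx_orthogonal_conj.
- by apply: doubly_stochastic_orthogonal_conj => //; [rewrite cohQ | exact: ltW].
- exact: has_spectrum_orthogonal_conj.
Qed.
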